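(* Let $0<a<b$ be real numbers. If $y\geq 1$, then $$\frac{b^{b-1}(a+y-1)^{a+y-1}}{a^{a-1}(b+y-1)^{b+y-1}}\leq\frac{B(b,y)}{B(a,y)}\leq \frac{a(b+1)^{b+1}(a+y)^{a+y}}{b(a+1)^{a+1}(b+y)^{b+y}}.$$
   Context: For real $x,y>0$, $B(x,y)=\int_0^1 t^{x-1}(1-t)^{y-1}\,dt$ denotes the (Euler) beta function. *)

(* Defs.v *)
From mathcomp Require Import all_boot all_order all_algebra.
From mathcomp Require Import all_classical all_reals all_analysis.

Set Implicit Arguments.
Unset Strict Implicit.
Unset Printing Implicit Defensive.

Import Order.TTheory GRing.Theory Num.Theory.
Import numFieldNormedType.Exports.
Local Open Scope classical_set_scope.
Local Open Scope ring_scope.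

(* The library's [beta_fun] only takes natural-number parameters.  The
   endpoints, where the integrand may be singular, are left out; they are
   Lebesgue-null, so this is the (improper) integral from 0 to 1.  For x, y > 0
   the integral is finite, hence the real-valued [\int] is the true value. *)
Definition euler_beta (R : realType) (x y : R) : R :=
  \int[@lebesgue_measure R]_(t in `]0, 1[) (t `^ (x - 1) * (1 - t) `^ (y - 1)).

(* Main.v *)
(** With [s = y - 1], taking logarithms reduces the two bounds to the monotonicity
    in [x] of
      [g x = ln B(x, y) + (x + s) ln (x + s) - (x - 1) ln x]       (nondecreasing)
      [h x = ln (x B(x, y)) + (x + y) ln (x + y) - (x + 1) ln (x + 1)]
                                                                   (nonincreasing).
    The functional equation [(x + y) B(x + 1, y) = x B(x, y)] turns [g x - g (x + 1)]
    and [h x - h (x + 1)] into elementary expressions in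
    [P e x = x ln (1 + e / x)], namely [P 1 x - P 1 (x + s)] and
    [P (-1) (x + 2 + s) - P (-1) (x + 2)], which are monotone in [x] by concavity
    of [P e].  Hence [g (a + n) - g (b + n)] and [h (b + n) - h (a + n)] are
    nondecreasing in [n]; as both are [O(1 / n)] from above, because [B(_, y)] is
    nonincreasing, their values at [n = 0] are nonpositive. *)
Require Import Defs.
From mathcomp Require Import all_boot all_order all_algebra.
From mathcomp Require Import all_classical all_reals all_analysis.
From mathcomp Require Import measurable_realfun.
From mathcomp Require Import ring lra.

Import Order.TTheory GRing.Theory Num.Theory.
Import numFieldNormedType.Exports.
Local Open Scope ring_scope.
Local Open Scope classical_set_scope.

(** * Logarithmic inequalities and concavity of [lnP] *)

Lemma ln_leB1 (R : realType) (x : R) : 0 < x -> ln x <= x - 1.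
Proof.
move=> x0; have := @le_ln1Dx R (x - 1).
by rewrite (addrC 1) subrK; apply; lra.
Qed.

(* [lnP e x = x * ln (1 + e / x)]; it is concave for either sign of [e], being
   the perspective of the concave function [ln (1 + e * _)]. *)
Definition lnP (R : realType) (e x : R) : R := x * (ln (x + e) - ln x).

(** The slope is the derivative of [lnP e] at [z]. The bound is [ln u <= u - 1] at
    [u = (x + e) z / (x (z + e))], multiplied by [x]. *)
Lemma lnP_tangent (R : realType) (e x z : R) :
  0 < x -> 0 < x + e -> 0 < z -> 0 < z + e ->
  lnP R e x <= lnP R e z + (ln (z + e) - ln z + z / (z + e) - 1) * (x - z).
Proof.
move=> x0 xe0 z0 ze0.
have u0 : 0 < (x + e) * z / (x * (z + e)) by rewrite divr_gt0 ?mulr_gt0.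
have := ln_leB1 R _ u0.
rewrite ln_div ?posrE ?mulr_gt0// !lnM ?posrE// -(ler_pM2l x0) => H.
rewrite /lnP -subr_ge0; move: H; rewrite -subr_ge0.
congr (0 <= _); field.
by rewrite !gt_eqF.
Qed.

(** The points [b] and [a + s] lie in [[a, b + s]] and have the same sum as its endpoints. By
    concavity both values lie above the chord, and the two chord inequalities add up to the
    claim. *)
Lemma lnP_four_point (R : realType) (e a b s : R) :
  0 < a -> 0 < a + e -> a < b -> 0 <= s ->
  lnP R e a + lnP R e (b + s) <= lnP R e b + lnP R e (a + s).
Proof.
move=> a0 ae0 ab s0.
have T x z : a <= x -> a <= z -> lnP R e x <= lnP R e z +
    (ln (z + e) - ln z + z / (z + e) - 1) * (x - z).
  by move=> ax az; apply: lnP_tangent; lra.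
set f := lnP R e in T *.
(* A line through [(z, f z)] that dominates [f] at both endpoints puts [f z] above the chord: in the
   weighted sum the terms in the slope [m] cancel. *)
have chord z m : a <= z <= b + s ->
    f a <= f z + m * (a - z) -> f (b + s) <= f z + m * (b + s - z) ->
    (b + s - z) * f a + (z - a) * f (b + s) <= (b + s - a) * f z.
  move=> /andP[az zd] h1 h2.
  have -> : (b + s - a) * f z = (b + s - z) * (f z + m * (a - z)) +
     (z - a) * (f z + m * (b + s - z)) by ring.
  by apply: lerD; apply: ler_wpM2l => //; lra.
have ab' := ltW ab.
have h1 : (b + s - b) * f a + (b - a) * f (b + s) <= (b + s - a) * f b.
  by apply: chord (T a b _ _) (T (b + s) b _ _); lra.
have h2 : (b + s - (a + s)) * f a + (a + s - a) * f (b + s) <=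
    (b + s - a) * f (a + s).
  by apply: chord (T a (a + s) _ _) (T (b + s) (a + s) _ _); lra.
have p0 : 0 < b + s - a by lra.
rewrite -(ler_pM2l p0) mulrDr [leRHS]mulrDr.
by apply: le_trans (lerD h1 h2); rewrite le_eqVlt; apply/orP; left; apply/eqP; ring.
Qed.

Lemma lnB_le (R : realType) (x z : R) : 0 < x -> x <= z -> ln z - ln x <= (z - x) / x.
Proof.
move=> x0 xz; have z0 : 0 < z by lra.
rewrite -ln_div ?posrE//; apply: le_trans (ln_leB1 R _ (divr_gt0 z0 x0)) _.
by rewrite mulrBl divff ?gt_eqF.
Qed.

(** Both sides come from [ln u <= u - 1], at [u = x / (x + s)] and at its inverse. The leading term
    [s] is the same in both, so it cancels in differences and leaves [O(1 / x)]. *)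
Lemma mul_lnB_bounds (R : realType) (s x : R) : 0 < x -> 0 <= s ->
  s <= (x + s) * (ln (x + s) - ln x) <= s + s ^+ 2 / x.
Proof.
move=> x0 s0; have xs0 : 0 < x + s by lra.
rewrite -ln_div ?posrE//; apply/andP; split.
- have := ln_leB1 R (x / (x + s)) (divr_gt0 x0 xs0).
  rewrite !ln_div ?posrE// -(ler_pM2l xs0).
  have -> : (x + s) * (x / (x + s) - 1) = - s by field; rewrite gt_eqF.
  by rewrite mulrBr mulrBr; lra.
- have := ln_leB1 R ((x + s) / x) (divr_gt0 xs0 x0).
  rewrite -(ler_pM2l xs0) => /le_trans; apply.
  rewrite le_eqVlt; apply/orP; left; apply/eqP; field.
  by rewrite gt_eqF.
Qed.

(** * Monotonicity from the functional equation *)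

Lemma nondecreasing_le_harmonic_le0 (R : realType) (u : nat -> R) (a C : R) :
  0 < a -> (forall n, u n <= u n.+1) -> (forall n, u n <= C / (a + n%:R)) ->
  u 0%N <= 0.
Proof.
move=> a0 uS uC; rewrite leNgt; apply/negP => u0.
have un n : u 0%N <= u n by elim: n => // n /le_trans; apply.
(* Since [n + 1 > C / u 0], the bound at index [n + 1] falls below [u 0], a contradiction. *)
set n := Num.truncn (C / u 0%N).
have := le_trans (un n.+1) (uC n.+1).
have an0 : 0 < a + n.+1%:R by rewrite ltr_wpDr.
rewrite ler_pdivlMr// mulrC -ler_pdivlMr//; apply/negP; rewrite -ltNge.
by apply: lt_trans (truncnS_gt (C / u 0%N)) _; rewrite ltrDr.
Qed.

(** Telescoping: the step from [x + k] to [x + k + 1] lowers [l] by [ln (1 + (s + 1) / (x + k))],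
    which is at most [(s + 1) / x]. *)
Lemma log_beta_shift_le (R : realType) (l : R -> R) (s : R) :
  0 <= s ->
  (forall x, 0 < x -> l (x + 1) = l x + ln x - ln (x + s + 1)) ->
  forall (x : R) (m : nat), 0 < x -> l x - l (x + m%:R) <= m%:R * (s + 1) / x.
Proof.
move=> s0 lS x m x0; elim: m => [|m IH]; first by rewrite addr0 subrr !mul0r.
have xm0 : 0 < x + m%:R by rewrite ltr_wpDr.
have m0 : (0 : R) <= m%:R by [].
have xs0 : 0 < x + m%:R + s + 1 by lra.
rewrite -natr1 addrA lS//.
have := ln_leB1 R ((x + m%:R + s + 1) / (x + m%:R)) (divr_gt0 xs0 xm0).
rewrite ln_div ?posrE//.
have -> : (x + m%:R + s + 1) / (x + m%:R) - 1 = (s + 1) / (x + m%:R).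
  by field; rewrite gt_eqF.
have : (s + 1) / (x + m%:R) <= (s + 1) / x.
  by apply: ler_wpM2l; [lra|rewrite lef_pV2 ?posrE//; lra].
by rewrite mulrDl mul1r mulrDl; lra.
Qed.

(** Here [l] stands for [ln B(_, s + 1)], known only through its functional equation and its
    monotonicity. *)
Lemma log_beta_lower (R : realType) (l : R -> R) (s : R) :
  0 <= s ->
  (forall x, 0 < x -> l (x + 1) = l x + ln x - ln (x + s + 1)) ->
  (forall x z, 0 < x -> x <= z -> l z <= l x) ->
  forall a b : R, 0 < a -> a < b ->
  l a + (a + s) * ln (a + s) - (a - 1) * ln a <=
  l b + (b + s) * ln (b + s) - (b - 1) * ln b.
Proof.
move=> s0 lS l_anti a b a0 ab.
pose g x := l x + (x + s) * ln (x + s) - (x - 1) * ln x.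
have gS x : 0 < x -> g x - g (x + 1) = lnP R 1 x - lnP R 1 (x + s).
  move=> x0; rewrite /g /lnP lS//.
  by rewrite (_ : x + 1 + s = x + s + 1); [ring|ring].
rewrite -/(g a) -/(g b) -subr_le0.
(* From [a + n], [m + 1] unit steps lead past [b + n]; as [l] is nonincreasing, this bounds
   [l (a + n) - l (b + n)] from above. *)
pose m := Num.truncn (b - a).
pose u n := g (a + n%:R) - g (b + n%:R).
rewrite (_ : g a - g b = u 0%N); last by rewrite /u !addr0.
(* The term [(m + 1) (s + 1)] comes from the unit steps of [l], and [s ^+ 2] from
   [mul_lnB_bounds]. *)
apply: (@nondecreasing_le_harmonic_le0 R u a (m.+1%:R * (s + 1) + s ^+ 2)) => // n;
  rewrite /u.
- have n0 : (0 : R) <= n%:R by [].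
  have := gS (a + n%:R); have := gS (b + n%:R).
  have := @lnP_four_point R 1 (a + n%:R) (b + n%:R) s.
  rewrite -[n.+1%:R]natr1 !addrA => h1 h2 h3.
  have {}h1 := h1 ltac:(lra) ltac:(lra) ltac:(lra) s0.
  have {}h2 := h2 ltac:(lra).
  have {}h3 := h3 ltac:(lra).
  lra.
- have n0 : (0 : R) <= n%:R by [].
  set A := a + n%:R; set B := b + n%:R.
  have A0 : 0 < A by rewrite /A; lra.
  have AB : A <= B by rewrite /A /B; lra.
  have Bm : B <= A + m.+1%:R.
    by rewrite /A /B; have := truncnS_gt (b - a); rewrite -/m; lra.
  have h1 := log_beta_shift_le R l s s0 lS A m.+1 A0.
  have h2 := l_anti B (A + m.+1%:R) ltac:(lra) Bm.
  have /andP[_ h3] := mul_lnB_bounds R s A A0 s0.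
  have /andP[h4 _] := mul_lnB_bounds R s B ltac:(lra) s0.
  have h5 : ln A <= ln B by rewrite ler_ln ?posrE//; lra.
  have h6 : (s + 1) * ln A <= (s + 1) * ln B by apply: ler_wpM2l => //; lra.
  rewrite mulrDl /g.
  lra.
Qed.

Lemma log_beta_upper (R : realType) (l : R -> R) (s : R) :
  0 <= s ->
  (forall x, 0 < x -> l (x + 1) = l x + ln x - ln (x + s + 1)) ->
  (forall x z, 0 < x -> x <= z -> l z <= l x) ->
  forall a b : R, 0 < a -> a < b ->
  l b + ln b + (b + s + 1) * ln (b + s + 1) - (b + 1) * ln (b + 1) <=
  l a + ln a + (a + s + 1) * ln (a + s + 1) - (a + 1) * ln (a + 1).
Proof.
move=> s0 lS l_anti a b a0 ab.
pose h x := l x + ln x + (x + s + 1) * ln (x + s + 1) - (x + 1) * ln (x + 1).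
have hS x : 0 < x ->
    h x - h (x + 1) = lnP R (-1) (x + 2 + s) - lnP R (-1) (x + 2).
  move=> x0; rewrite /h /lnP lS//.
  rewrite (_ : x + 1 + s + 1 = x + 2 + s); last by ring.
  rewrite (_ : x + 2 + s - 1 = x + s + 1); last by ring.
  rewrite (_ : x + 1 + 1 = x + 2); last by ring.
  by rewrite (_ : x + 2 - 1 = x + 1); ring.
rewrite -/(h a) -/(h b) -subr_le0.
pose u n := h (b + n%:R) - h (a + n%:R).
rewrite (_ : h b - h a = u 0%N); last by rewrite /u !addr0.
(* Now [l] enters as [l (b + n) - l (a + n) <= 0], so no unit steps are counted. The differences of
   logarithms contribute [(s + 1) (b - a)], and [mul_lnB_bounds] contributes [s ^+ 2]. *)
apply: (@nondecreasing_le_harmonic_le0 R u a (s ^+ 2 + (s + 1) * (b - a))) => // n;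
  rewrite /u.
- have n0 : (0 : R) <= n%:R by [].
  have := hS (a + n%:R); have := hS (b + n%:R).
  have := @lnP_four_point R (-1) (a + n%:R + 2) (b + n%:R + 2) s.
  rewrite -[n.+1%:R]natr1 !addrA => h1 h2 h3.
  have {}h1 := h1 ltac:(lra) ltac:(lra) ltac:(lra) s0.
  have {}h2 := h2 ltac:(lra).
  have {}h3 := h3 ltac:(lra).
  lra.
- have n0 : (0 : R) <= n%:R by [].
  set A := a + n%:R; set B := b + n%:R.
  have A0 : 0 < A by rewrite /A; lra.
  have AB : A <= B by rewrite /A /B; lra.
  have BA : B - A = b - a by rewrite /A /B; ring.
  have h1 := l_anti A B A0 AB.
  have h2 := lnB_le R A B A0 AB.
  have h3 : s * (ln (B + 1) - ln (A + 1)) <= s * ((b - a) / A).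
    apply: ler_wpM2l => //.
    have := lnB_le R (A + 1) (B + 1) ltac:(lra) ltac:(lra).
    move=> /le_trans; apply.
    rewrite (_ : B + 1 - (A + 1) = b - a); last by rewrite -BA; ring.
    by apply: ler_wpM2l; [lra|rewrite lef_pV2 ?posrE//; lra].
  have /andP[h4 _] := mul_lnB_bounds R s (A + 1) ltac:(lra) s0.
  have /andP[_ h5] := mul_lnB_bounds R s (B + 1) ltac:(lra) s0.
  have h6 : s ^+ 2 / (B + 1) <= s ^+ 2 / A.
    by apply: ler_wpM2l; [exact: sqr_ge0|rewrite lef_pV2 ?posrE//; lra].
  rewrite /h (addrAC _ s 1) (addrAC _ s 1).
  move: h2; rewrite BA => h2.
  have -> : (s ^+ 2 + (s + 1) * (b - a)) / A =
    s ^+ 2 / A + s * ((b - a) / A) + (b - a) / A by ring.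
  lra.
Qed.


(** * The fundamental theorem of calculus on an open interval *)

(** The open interval is exhausted by compact ones, on which the usual theorem applies.
    Nonnegativity of [f] gives monotone convergence, so [f] may be unbounded near the endpoints. *)
Lemma ge0_FTC2_oo (R : realType) (f F : R -> R) (a b la lb : R) : a < b ->
  (forall x, a < x < b -> 0 <= f x) ->
  (forall x, a < x < b -> {for x, continuous f}) ->
  (forall x, a < x < b -> is_derive x 1 F (f x)) ->
  F x @[x --> a^'+] --> la -> F x @[x --> b^'-] --> lb ->
  (\int[@lebesgue_measure R]_(x in `]a, b[) (f x)%:E = (lb - la)%:E)%E.
Proof.
move=> ab f0 cf dF Fa Fb.
(* The factor [3^-1] makes [[a + e n, b - e n]] nondegenerate already at [n = 0]. *)
pose e n : R := (b - a) * 3^-1 * n.+1%:R^-1.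
have c0 : 0 < (b - a) * 3^-1 by rewrite mulr_gt0// subr_gt0.
have e0 n : 0 < e n by rewrite /e mulr_gt0.
have ele n : e n <= (b - a) * 3^-1.
  by rewrite /e ler_piMr ?(ltW c0)// invf_le1// ler1n.
have eS m n : (m <= n)%N -> e n <= e m.
  by move=> mn; rewrite /e ler_pM2l// lef_pV2 ?posrE// ler_nat.
have ecvg : e n @[n --> \oo] --> 0.
  rewrite -[X in _ --> X](mulr0 ((b - a) * 3^-1)).
  by apply: cvgM; [exact: cvg_cst|exact: cvg_harmonic].
have inA n x : a + e n <= x <= b - e n -> a < x < b.
  by move=> /andP[h1 h2]; have := e0 n; lra.
pose A n : set R := `[a + e n, b - e n].
have IA n : (\int[@lebesgue_measure R]_(x in A n) (f x)%:E =
    (F (b - e n) - F (a + e n))%:E)%E.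
  have An : a + e n < b - e n by have := ele n; have := c0; lra.
  have cF : {within `[a + e n, b - e n], continuous F}.
    apply: derivable_within_continuous => x; rewrite in_itv/= => /inA/dF dFx.
    exact: ex_derive.
  rewrite (@continuous_FTC2 _ f F) ?EFinB//.
  - apply: continuous_in_subspaceT => x; rewrite inE/= in_itv/= => /inA.
    exact: cf.
  - have [_ h1 h2] := (continuous_within_itvP _ An).1 cF.
    split => // x; rewrite in_itv/= => /andP[x1 x2].
    by apply: (@ex_derive _ _ _ _ _ _ _ (dF x _)); apply: (inA n); rewrite !ltW.
  - move=> x; rewrite in_itv/= => /andP[x1 x2]; rewrite derive1E.
    by apply: (@derive_val _ _ _ _ _ _ _ (dF x _)); apply: (inA n); rewrite !ltW.
have UA : \bigcup_n A n = `]a, b[.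
  apply/seteqP; split => x /=.
    by move=> [n _]; rewrite /A/= !in_itv/= => /inA.
  rewrite in_itv/= => /andP[ax xb].
  have m0 : 0 < Num.min (x - a) (b - x) by rewrite lt_min !subr_gt0 ax.
  have [n _ /(_ _ (leqnn _))] := (cvgrPdist_lt _ _).1 ecvg _ m0.
  rewrite /= sub0r normrN gtr0_norm// lt_min => /andP[h1 h2].
  by exists n => //; rewrite /A/= in_itv/=; apply/andP; split; lra.
have cvgI : (\int[@lebesgue_measure R]_(x in A n) (f x)%:E)%E @[n --> \oo] -->
    (\int[@lebesgue_measure R]_(x in `]a, b[) (f x)%:E)%E.
  rewrite -UA; apply: ge0_nondecreasing_set_cvg_integral.
  - move=> m n mn; rewrite subsetEset => x; rewrite /A/= !in_itv/= => /andP[].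
    by have := eS _ _ mn => ? ? ?; apply/andP; split; lra.
  - by move=> n; exact: measurable_itv.
  - move=> n; apply/measurable_EFinP.
    apply: (@measurable_funS _ _ _ _ `]a, b[) => //.
      by move=> x; rewrite /A/= !in_itv/= => /inA.
    apply: open_continuous_measurable_fun => // x.
    by rewrite inE/= in_itv/=; exact: cf.
  - by move=> n x; rewrite /A/= in_itv/= lee_fin => /inA/f0.
have cvgF : (F (b - e n) - F (a + e n))%:E @[n --> \oo] --> (lb - la)%:E.
  apply: cvg_EFin; first exact: nearW.
  apply: cvgB.
  - apply: (cvg_at_leftP _ _ _).1 Fb _ _; split; first by move=> n; rewrite ltrBlDr ltrDl.
    by rewrite -[X in _ --> X]subr0; apply: cvgB => //; exact: cvg_cst.
  - apply: (cvg_at_rightP _ _ _).1 Fa _ _; split; first by move=> n; rewrite ltrDl.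
    by rewrite -[X in _ --> X]addr0; apply: cvgD => //; exact: cvg_cst.
move: cvgI; under eq_cvg do rewrite IA.
by move=> h; apply: cvg_unique h cvgF.
Qed.

Lemma continuous_is_derive (R : realType) (f : R -> R) (x df : R) :
  is_derive x 1 f df -> {for x, continuous f}.
Proof.
by move=> fx; apply/differentiable_continuous/derivable1_diffP; exact: ex_derive.
Qed.

Lemma is_derive_powR_onem (R : realType) (p t : R) : t < 1 ->
  is_derive t 1 (fun u => (1 - u) `^ p) (- (p * (1 - t) `^ (p - 1))).
Proof.
move=> t1; have p1 : 0 < 1 - t by rewrite subr_gt0.
have dg : is_derive t 1 (fun u : R => 1 - u) (- 1).
  have := is_deriveB (is_derive_cst (1 : R) t 1) (is_derive_id t 1).
  by rewrite sub0r.
have := @is_derive1_comp R (@powR R ^~ p) (fun u => 1 - u) t _ _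
  (is_derive1_powR p p1) dg.
by rewrite mulrN1.
Qed.

(** * Integrability, positivity and functional equation of the beta integral *)

Section beta_integrand.
Variables (R : realType).
Implicit Types x y t : R.
Notation mu := (@lebesgue_measure R).

Let w x y t := t `^ (x - 1) * (1 - t) `^ (y - 1).

Let powR_le1 t p : 0 < t < 1 -> 0 <= p -> t `^ p <= 1.
Proof.
move=> /andP[t0 t1] p0; rewrite -[leRHS](powRr0 t).
by apply: ger_powR => //; rewrite t0 ltW.
Qed.

Let measurable_w x y : measurable_fun setT (w x y).
Proof.
apply: measurable_funM => //=.
apply: (measurableT_comp (measurable_powR (y - 1))).
exact: measurable_funB.
Qed.

Let in01_onem t : 0 < t < 1 -> 0 < 1 - t < 1.
Proof. by move=> /andP[? ?]; apply/andP; split; lra. Qed.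

Lemma integrable_powR01 x : 0 < x ->
  mu.-integrable `]0, 1[ (EFin \o (fun t => t `^ (x - 1))).
Proof.
move=> x0; apply/integrableP; split.
  by apply/measurable_EFinP; apply: measurable_funTS; exact: measurable_powR.
have dF t : 0 < t -> is_derive t 1 (fun u => x^-1 * u `^ x) (t `^ (x - 1)).
  move=> t0.
  have := is_deriveM (is_derive_cst x^-1 t 1) (is_derive1_powR x t0).
  rewrite scaler0 addr0 /GRing.scale/= mulrA mulVf ?gt_eqF// mul1r.
  exact.
have -> : (\int[mu]_(t in `]0%R, 1%R[) `|(EFin \o (fun t => (t `^ (x - 1))%R)) t| =
   (x^-1 * 1 `^ x - 0)%:E)%E.
  under eq_integral do rewrite /= ger0_norm ?powR_ge0//.
  apply: (@ge0_FTC2_oo _ (fun t => t `^ (x - 1)) (fun u => x^-1 * u `^ x)) => //.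
  - by move=> t _; exact: powR_ge0.
  - move=> t /andP[t0 _].
    exact: continuous_is_derive (is_derive1_powR (x - 1) t0).
  - by move=> t /andP[t0 _]; exact: dF.
  - rewrite -[X in _ --> X](mulr0 x^-1).
    by apply: cvgM; [exact: cvg_cst|exact: powR_cvg0].
  - apply: cvg_at_left_filter.
    exact: continuous_is_derive (dF 1 ltr01).
by rewrite ltry.
Qed.

(** For [y >= 1] the factor [(1 - t)]^ (y - 1)[is at most 1, so]t [^ (x - 1)] dominates. *)
Lemma integrable_beta x y : 0 < x -> 1 <= y ->
  mu.-integrable `]0, 1[ (EFin \o w x y).
Proof.
move=> x0 y1; apply: le_integrable (integrable_powR01 x x0) => //.
  by apply/measurable_EFinP; apply: measurable_funTS; exact: measurable_w.
move=> t; rewrite /= in_itv/= => t01; rewrite lee_fin.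
rewrite !ger0_norm ?mulr_ge0 ?powR_ge0// ler_piMr ?powR_ge0//.
by apply: powR_le1; [exact: in01_onem|lra].
Qed.

Lemma euler_beta_anti x1 x2 y : 0 < x1 -> x1 <= x2 -> 1 <= y ->
  euler_beta x2 y <= euler_beta x1 y.
Proof.
move=> x10 x12 y1; have x20 : 0 < x2 by lra.
apply: le_Rintegral => //; [exact: integrable_beta|exact: integrable_beta|].
move=> t; rewrite /= in_itv/= => /andP[t0 t1].
apply: ler_wpM2r; first exact: powR_ge0.
by apply: ger_powR; [rewrite t0 ltW|lra].
Qed.

Lemma euler_beta_gt0 x y : 0 < x -> 1 <= y -> 0 < euler_beta x y.
Proof.
move=> x0 y1.
pose c : R := 4^-1 `^ x * 2^-1 `^ (y - 1).
have c0 : 0 < c by rewrite mulr_gt0 ?powR_gt0.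
have iw := integrable_beta x y x0 y1.
rewrite -lte_fin /euler_beta /Rintegral fineK; last exact: integrable_fin_num iw.
apply: (@lt_le_trans _ _ (\int[mu]_(t in `[4^-1%R, 2^-1%R]) (w x y t)%:E)%E).
  apply: (@lt_le_trans _ _ (\int[mu]_(t in `[4^-1%R, 2^-1%R]) (cst c%:E t))%E).
    rewrite integral_cst//= lebesgue_measure_itv/= lte_fin.
    rewrite ifT; last by lra.
    by rewrite -EFinB -EFinM lte_fin mulr_gt0//; lra.
  apply: ge0_le_integral => //=.
  - by move=> t _; rewrite lee_fin ltW.
  - by apply/measurable_EFinP; apply: measurable_funTS; exact: measurable_w.
  - move=> t; rewrite /= in_itv/= => /andP[t4 t2].
    rewrite lee_fin; apply: ler_pM; rewrite ?powR_ge0//.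
      apply: (@le_trans _ _ (t `^ x)).
        by apply: ge0_ler_powR; rewrite ?nnegrE; lra.
      by apply: ger_powR; lra.
    by apply: ge0_ler_powR; rewrite ?nnegrE; lra.
apply: ge0_subset_integral => //=.
- by case/integrableP: iw.
- by move=> t _; rewrite lee_fin mulr_ge0 ?powR_ge0.
- by move=> t; rewrite /= !in_itv/= => /andP[t4 t2]; apply/andP; split; lra.
Qed.

(** The derivative of [t]^ x * (1 - t) [^ y] is [x w x y - (x + y) w (x + 1) y]. Its integral is
    zero because the primitive vanishes at both ends. *)
Lemma euler_betaS x y : 0 < x -> 1 <= y ->
  x * euler_beta x y = (x + y) * euler_beta (x + 1) y.
Proof.
move=> x0 y1.
have x10 : 0 < x + 1 by lra.
have i1 := integrable_beta x y x0 y1.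
have i2 := integrable_beta (x + 1) y x10 y1.
pose f t := x * w x y t - (x + y) * w (x + 1) y t.
pose F t := t `^ x * (1 - t) `^ y.
have dF t : 0 < t < 1 -> is_derive t 1 F (f t).
  move=> /andP[t0 t1].
  have p0 : 0 < 1 - t by lra.
  have := is_deriveM (is_derive1_powR x t0) (is_derive_powR_onem _ y t t1).
  rewrite /GRing.scale/= => h; apply: (is_derive_eq h).
  rewrite /f /w addrK -(mulr_powRB1 (ltW t0) x0).
  rewrite -(mulr_powRB1 (ltW p0) (lt_le_trans ltr01 y1)).
  ring.
have cw z t : 0 < t < 1 -> {for t, continuous (w z y)}.
  move=> /andP[t0 t1]; apply: cvgM.
    exact: continuous_is_derive (is_derive1_powR (z - 1) t0).
  exact: continuous_is_derive (is_derive_powR_onem _ (y - 1) t t1).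
have F01 t : 0 < t < 1 -> 0 <= F t <= Num.min (t `^ x) (1 - t).
  move=> t01; have ot01 := in01_onem t t01.
  rewrite mulr_ge0 ?powR_ge0//= le_min; apply/andP; split.
    by rewrite ler_piMr ?powR_ge0// powR_le1//; lra.
  apply: (@le_trans _ _ ((1 - t) `^ y)).
    by rewrite ler_piMl ?powR_ge0// powR_le1// ltW.
  by apply: ge1r_powR => //; lra.
(* Adding [y] to the derivative of [F] makes it nonnegative, so that
   [ge0_FTC2_oo] applies although [F'] changes sign. *)
have intF : (\int[mu]_(t in `]0%R, 1%R[) (f t + y)%:E =
    (0 + y * 1 - (0 + y * 0))%:E)%E.
  apply: (@ge0_FTC2_oo _ (fun t => f t + y) (fun t => F t + y * t)) => //.
  - move=> t t01.
    have -> : f t + y = x * (t `^ (x - 1) * (1 - t) `^ y) +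
        y * (1 - t `^ x * (1 - t) `^ (y - 1)).
      move: t01 => /andP[t0 t1]; have p0 : 0 < 1 - t by lra.
      rewrite /f /w addrK -(mulr_powRB1 (ltW t0) x0).
      rewrite -(mulr_powRB1 (ltW p0) (lt_le_trans ltr01 y1)).
      ring.
    have ot01 := in01_onem t t01.
    rewrite addr_ge0 ?mulr_ge0 ?powR_ge0 ?(ltW x0)//; first by lra.
    by rewrite subr_ge0 mulr_ile1 ?powR_ge0// powR_le1//; lra.
  - move=> t t01; apply: cvgD; last exact: cvg_cst.
    by apply: cvgB; (apply: cvgM; [exact: cvg_cst|exact: cw]).
  - move=> t t01.
    have := is_deriveD (dF t t01)
      (is_deriveM (is_derive_cst y t 1) (is_derive_id t 1)).
    by rewrite scaler0 addr0 /GRing.scale/= mulr1.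
  - apply: cvgD; last first.
      by apply: cvgM; [exact: cvg_cst|exact: cvg_at_right_filter].
    apply: (@squeeze_cvgr _ _ _ _ (cst 0) (@powR R ^~ x)).
    + near=> t.
      have /F01 : 0 < t < 1 by apply/andP; split.
      by rewrite le_min => /and3P[-> ->].
    + exact: cvg_cst.
    + exact: powR_cvg0.
  - apply: cvgD; last first.
      by apply: cvgM; [exact: cvg_cst|exact: cvg_at_left_filter].
    apply: (@squeeze_cvgr _ _ _ _ (cst 0) (fun t => 1 - t)).
    + near=> t.
      have /F01 : 0 < t < 1 by apply/andP; split.
      by rewrite le_min => /and3P[-> _ ->].
    + exact: cvg_cst.
    + rewrite -[X in _ --> X](subrr (1 : R)).
      by apply: cvgB; [exact: cvg_cst|exact: cvg_at_left_filter].
have iy : mu.-integrable `]0, 1[ (EFin \o cst y).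
  apply/integrableP; split.
    by apply/measurable_EFinP; exact: measurable_cst.
  rewrite (integral_cst mu (measurable_itv `]0%R, 1%R[%R) `|y|%:E).
  by rewrite [X in (_ * X)%E]lebesgue_measure_itv/= lte_fin ltr01 -EFinB -EFinM ltry.
have iZ1 : mu.-integrable `]0, 1[ (EFin \o (fun t => x * w x y t)).
  by apply: (@integrableZl _ _ _ mu `]0, 1[ _ x _ i1).
have iZ2 : mu.-integrable `]0, 1[ (EFin \o (fun t => (x + y) * w (x + 1) y t)).
  by apply: (@integrableZl _ _ _ mu `]0, 1[ _ (x + y) _ i2).
have if0 : mu.-integrable `]0, 1[ (EFin \o f).
  by apply: (@integrableB _ _ _ mu `]0, 1[ _ _ _ iZ1 iZ2).
have mI : measurable (`]0, 1[ : set R) by exact: measurable_itv.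
have fy : \int[mu]_(t in `]0, 1[) (f t + cst y t) = y.
  by rewrite /Rintegral intF/=; ring.
have Dfy := @RintegralD _ _ _ mu `]0, 1[ f (cst y) mI if0 iy.
have Bf := @RintegralB _ _ _ mu `]0, 1[ _ _ mI iZ1 iZ2.
have Z1 := @RintegralZl _ _ _ mu `]0, 1[ _ x mI i1.
have Z2 := @RintegralZl _ _ _ mu `]0, 1[ _ (x + y) mI i2.
have cy : \int[mu]_(t in `]0, 1[) cst y t = y.
  by rewrite Rintegral_cst//= lebesgue_measure_itv/= lte_fin ltr01/= subr0 mulr1.
have : \int[mu]_(t in `]0, 1[) f t = 0.
  by move: fy; rewrite Dfy cy => /eqP; rewrite -subr_eq0 addrK => /eqP.
rewrite Bf Z1 Z2 => /eqP; rewrite subr_eq0 => /eqP; exact.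
Unshelve. all: by end_near.
Qed.

End beta_integrand.

(** * Application to the beta function *)

Lemma ln_euler_betaS (R : realType) (x s : R) : 0 < x -> 0 <= s ->
  ln (euler_beta (x + 1) (s + 1)) =
  ln (euler_beta x (s + 1)) + ln x - ln (x + s + 1).
Proof.
move=> x0 s0; have s1 : 1 <= s + 1 by lra.
have B0 := euler_beta_gt0 R x (s + 1) x0 s1.
have B10 : 0 < euler_beta (x + 1) (s + 1) by apply: euler_beta_gt0; lra.
have xs1 : 0 < x + s + 1 by lra.
move: (euler_betaS R x (s + 1) x0 s1) B0 B10; rewrite addrA.
move: (euler_beta x _) (euler_beta (x + 1) _) => B B1 eB B0 B10.
by move: (congr1 (@ln R) eB); rewrite !lnM ?posrE//; lra.
Qed.

Theorem theorem2p6 (R : realType) (a b y : R)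
    (ha : 0 < a) (hab : a < b) (hy : 1 <= y) :
  (b `^ (b - 1) * (a + y - 1) `^ (a + y - 1))
    / (a `^ (a - 1) * (b + y - 1) `^ (b + y - 1))
    <= euler_beta b y / euler_beta a y
  /\
  euler_beta b y / euler_beta a y
    <= (a * (b + 1) `^ (b + 1) * (a + y) `^ (a + y))
       / (b * (a + 1) `^ (a + 1) * (b + y) `^ (b + y)).
Proof.
have [s s0 ->] : exists2 s, 0 <= s & y = s + 1.
  by exists (y - 1); rewrite ?subrK// subr_ge0.
have s1 : 1 <= s + 1 by lra.
pose l x := ln (euler_beta x (s + 1)).
have lS x : 0 < x -> l (x + 1) = l x + ln x - ln (x + s + 1).
  by move=> x0; exact: ln_euler_betaS.
have l_anti x z : 0 < x -> x <= z -> l z <= l x.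
  move=> x0 xz; rewrite /l ler_ln ?posrE ?euler_beta_gt0//; last by lra.
  exact: euler_beta_anti.
have b0 : 0 < b by lra.
have Ba0 := euler_beta_gt0 R a (s + 1) ha s1.
have Bb0 := euler_beta_gt0 R b (s + 1) b0 s1.
have a10 : 0 < a + 1 by lra.
have b10 : 0 < b + 1 by lra.
have as0 : 0 < a + s by lra.
have bs0 : 0 < b + s by lra.
have as10 : 0 < a + s + 1 by lra.
have bs10 : 0 < b + s + 1 by lra.
rewrite !addrA !addrK.
have lower := log_beta_lower R l s s0 lS l_anti a b ha hab.
have upper := log_beta_upper R l s s0 lS l_anti a b ha hab.
rewrite /l in lower upper.
move: (euler_beta a _) (euler_beta b _) Ba0 Bb0 lower upper => Ba Bb Ba0 Bb0 lo up.
(* All quantities are positive, so logarithms may be taken; each bound is then a linear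
   rearrangement of [lo] or [up]. *)
by split; rewrite -ler_ln ?posrE ?divr_gt0 ?mulr_gt0 ?powR_gt0//;
  rewrite !ln_div ?posrE ?mulr_gt0 ?powR_gt0//;
  rewrite !lnM ?posrE ?mulr_gt0 ?powR_gt0// !ln_powR; lra.
Qed.
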